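(* Let $k\ge 0$ and $\delta\ge k+2$ be integers, and let $n$ be sufficiently large (i.e. $n\ge n_0(k,\delta)$ for some $n_0$ depending only on $k$ and $\delta$). If $G$ is an $n$-vertex graph with minimum degree $\delta(G)\ge\delta$ and $$\lambda(G)\ge n-\delta+k-1,$$ then $G$ is $k$-Hamiltonian unless $G=H_{n,k,\delta}$ or $G=L_{n,k,\delta}$.
   Context: All graphs are finite and simple; equality of graphs means isomorphism. $\lambda(G)$ denotes the spectral radius of $G$, i.e. the largest eigenvalue of the adjacency matrix $A(G)$. $K_s$ is the complete graph on $s$ vertices, $I_t$ is the edgeless graph on $t$ vertices, $G\cup H$ is the disjoint union, and $G\vee H$ is the join (obtained from $G\cup H$ by adding all edges between $G$ and $H$). A graph is Hamiltonian if it has a Hamilton cycle (a cycle through all vertices). A graph $G=(V,E)$ is $k$-Hamiltonian if for all $X\subseteq V$ with $|X|\le k$, the subgraph induced by $V\setminus X$ is Hamiltonian. Define $$H_{n,k,\delta}:=K_\delta\vee(K_{n-2\delta+k}\cup I_{\delta-k}),\qquad L_{n,k,\delta}:=K_{k+1}\vee(K_{n-\delta-1}\cup K_{\delta-k}).$$ *)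

(* Defs.v *)
From HB Require Import structures.
From mathcomp Require Import all_boot all_order all_algebra.
From mathcomp Require Import classical_sets reals.

Set Implicit Arguments.
Unset Strict Implicit.
Unset Printing Implicit Defensive.

Import Order.TTheory GRing.Theory Num.Theory.

Record sgraph := SGraph {
  vertex :> finType;
  edge : rel vertex;
  edge_sym : symmetric edge;
  edge_irr : irreflexive edge }.

Arguments edge {s} x y.

Definition isomorphic (G H : sgraph) : Prop :=
  exists2 f : G -> H, bijective f & forall x y, edge (f x) (f y) = edge x y.

Section Constructions.

Definition complete_rel (n : nat) : rel 'I_n := fun x y => x != y.

Fact complete_sym n : symmetric (@complete_rel n).
Proof. by move=> x y; rewrite /complete_rel eq_sym. Qed.

Fact complete_irr n : irreflexive (@complete_rel n).
Proof. by move=> x; rewrite /complete_rel eqxx. Qed.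

Definition complete_graph (n : nat) : sgraph :=
  SGraph (@complete_sym n) (@complete_irr n).

Definition edgeless_rel (n : nat) : rel 'I_n := fun _ _ => false.

Fact edgeless_sym n : symmetric (@edgeless_rel n).
Proof. by []. Qed.

Fact edgeless_irr n : irreflexive (@edgeless_rel n).
Proof. by []. Qed.

Definition edgeless_graph (n : nat) : sgraph :=
  SGraph (@edgeless_sym n) (@edgeless_irr n).

Variables G H : sgraph.

Definition union_rel : rel (G + H)%type := fun u v =>
  match u, v with
  | inl x, inl y => edge x y
  | inr x, inr y => edge x y
  | _, _ => false
  end.

Fact union_sym : symmetric union_rel.
Proof. by case=> [x|x] [y|y] //=; rewrite edge_sym. Qed.

Fact union_irr : irreflexive union_rel.
Proof. by case=> x /=; rewrite edge_irr. Qed.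

Definition disjoint_union : sgraph := SGraph union_sym union_irr.

Definition join_rel : rel (G + H)%type := fun u v =>
  match u, v with
  | inl x, inl y => edge x y
  | inr x, inr y => edge x y
  | _, _ => true
  end.

Fact join_sym : symmetric join_rel.
Proof. by case=> [x|x] [y|y] //=; rewrite edge_sym. Qed.

Fact join_irr : irreflexive join_rel.
Proof. by case=> x /=; rewrite edge_irr. Qed.

Definition join : sgraph := SGraph join_sym join_irr.

Variable A : {set G}.

Definition induced_rel : rel {x : G | x \in A} :=
  fun x y => edge (val x) (val y).

Fact induced_sym : symmetric induced_rel.
Proof. by move=> x y; apply: edge_sym. Qed.

Fact induced_irr : irreflexive induced_rel.
Proof. by move=> x; apply: edge_irr. Qed.

Definition induced : sgraph := SGraph induced_sym induced_irr.

End Constructions.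

Definition degree (G : sgraph) (v : G) : nat := #|[set u : G | edge v u]|.

(* Every degree is less than #|G|, so the default value #|G| only matters
   for the graph without vertices. *)
Definition min_degree (G : sgraph) : nat :=
  \big[minn/#|G|]_(v : G) degree v.

(* [ucycle] accepts [:: x; y] for an edge xy, which is not a cycle of a simple
   graph; hence the lower bound on the length. *)
Definition hamiltonian (G : sgraph) : Prop :=
  exists p : seq G, [/\ 2 < size p, ucycle edge p & forall x, x \in p].

Definition k_hamiltonian (k : nat) (G : sgraph) : Prop :=
  forall X : {set G}, #|X| <= k -> hamiltonian (induced (~: X)).

Local Open Scope ring_scope.

Definition adjacency (R : realType) (G : sgraph) : 'M[R]_#|G| :=
  \matrix_(i, j) (edge (enum_val i) (enum_val j))%:R.

(* The largest eigenvalue: when G has a vertex, the set of eigenvalues of its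
   (symmetric) adjacency matrix is finite and nonempty, so that the supremum
   is a maximum. *)
Definition spectral_radius (R : realType) (G : sgraph) : R :=
  sup [set a : R | eigenvalue (adjacency R G) a]%classic.

Local Close Scope ring_scope.

(* The subtraction n - 2 * delta is the truncated one of [nat]; the graph is
   the intended one (on n vertices) for k <= delta and 2 * delta <= n. *)
Definition graphH (n k delta : nat) : sgraph :=
  join (complete_graph delta)
    (disjoint_union (complete_graph (n - 2 * delta + k))
                    (edgeless_graph (delta - k))).

(* Likewise, for k <= delta and delta < n. *)
Definition graphL (n k delta : nat) : sgraph :=
  join (complete_graph k.+1)
    (disjoint_union (complete_graph (n - delta - 1))
                    (complete_graph (delta - k))).

(* Main.v *)
Require Import Defs.
From mathcomp Require Import boolp classical_sets.
From mathcomp Require Import all_boot all_order all_algebra.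
From mathcomp Require Import reals zify ring lra.

(* Write c = delta - k. The absolute values of a top eigenvector, scaled to have
   maximum 1, give y >= 0 with A y >= (n - c - 1) y, whence the total deficiency
   sum (1 - y v) is at most c. If G - X is not Hamiltonian, pass to an
   edge-maximal non-Hamiltonian supergraph of it: by Bondy and Chvatal its
   vertices of degree at least half the order form a clique, and the set T of
   the others is small because y <= 2/3 on T. Maximality then bounds the degrees
   in T by |T|, and the row of A y >= (n - c - 1) y at the maximum of y gives
   |T| <= c. The minimum degree turns all these bounds into equalities:
   |T| = c, |X| = k, T is complete to X and to a set B of the clique, and sees
   nothing else outside T. For 1 < |B| < c there would be a Hamilton cycle,
   while |B| = 1 and |B| = c place G inside L and H. A missing edge outside T
   would push the spectral radius below n - c - 1. *)

Set Implicit Arguments.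
Unset Strict Implicit.
Unset Printing Implicit Defensive.

Import Order.TTheory GRing.Theory Num.Theory.

(** * Spectral radius, and the inequality [A y >= a y] for a nonnegative [y] *)

Section SpectralRadius.

Local Open Scope ring_scope.

Lemma poly_roots_in_seq (F : fieldType) (p : {poly F}) :
  p != 0 -> exists s : seq F, forall x, root p x -> x \in s.
Proof.
have [m] := ubnP (size p); elim: m p => // m IHm p /ltnSE le_m p_neq0.
have [[x px]|noroot] := pselect (exists x, root p x); last first.
  by exists [::] => x px; case: noroot; exists x.
have [q def_p] := factor_theorem _ _ px.
have q_neq0 : q != 0 by apply: contraNneq p_neq0 => q0; rewrite def_p q0 mul0r.
have [|s q_s] := IHm q _ q_neq0.
  by rewrite (leq_trans _ le_m) // def_p size_Mmonic ?monicXsubC // size_XsubC addn2.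
exists (x :: s) => y; rewrite def_p rootM root_XsubC inE => /orP[/q_s->|->//].
by rewrite orbT.
Qed.

Lemma seq_has_max (d : Order.disp_t) (T : orderType d) (s : seq T) :
  s != [::] -> exists2 m, m \in s & {in s, forall x, (x <= m)%O}.
Proof.
elim: s => // x [|y s] IHs _.
  by exists x; rewrite ?inE // => z; rewrite inE => /eqP->.
have [//|m ms max] := IHs; have [le_mx|lt_xm] := leP m x.
  exists x; first exact: mem_head.
  by move=> z; rewrite in_cons => /predU1P[->//|/max/le_trans]; apply.
exists m; first by rewrite in_cons ms orbT.
by move=> z; rewrite in_cons => /predU1P[->|/max//]; apply: ltW.
Qed.

(** Positivity excludes an empty spectrum, whose [sup] is 0. A nonempty spectrum lies among the
    finitely many roots of the characteristic polynomial, so its supremum is attained. *)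
Lemma spectral_radius_eigenvalue (R : realType) (G : sgraph) :
  0 < spectral_radius R G ->
  eigenvalue (adjacency R G) (spectral_radius R G).
Proof.
rewrite /spectral_radius; set A := adjacency R G; set E := [set a | _]%classic.
move=> supE_gt0.
have [s A_s] := poly_roots_in_seq (monic_neq0 (char_poly_monic A)).
have [m] : exists2 m, m \in filter (eigenvalue A) s &
    {in filter (eigenvalue A) s, forall x, x <= m}.
  apply: seq_has_max; apply/eqP => s_nil; move: supE_gt0.
  rewrite (_ : E = classical_sets.set0) ?sup0 ?ltxx //; apply/seteqP; split=> // x Ex.
  have : x \in filter (eigenvalue A) s.
    by rewrite mem_filter [eigenvalue A x]Ex A_s // -eigenvalue_root_char.
  by rewrite s_nil.
rewrite mem_filter => /andP[Am _] max_m.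
suff -> : sup E = m by [].
have ubE : ubound E m.
  move=> x Ex; apply: max_m.
  by rewrite mem_filter [eigenvalue A x]Ex A_s // -eigenvalue_root_char.
apply/le_anti; rewrite ge_sup /=; [|by exists m|exact: ubE].
by apply: ub_le_sup => //; exists m.
Qed.

(** By the triangle inequality the absolute values of an eigenvector satisfy the eigenvalue equation
    as an inequality; dividing by the largest of them makes the maximum 1. *)
Lemma subeigenvector (R : realType) (G : sgraph) (a : R) :
  eigenvalue (adjacency R G) a ->
  exists y : G -> R, [/\ forall v, 0 <= y v <= 1, exists w, y w = 1 &
    forall v, a * y v <= \sum_(u | edge v u) y u].
Proof.
move=> /eigenvalueP[x xA x_neq0].
pose z (u : G) : R := `|x 0 (enum_rank u)|.
have [i xi_neq0] : exists i, x 0 i != 0.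
  have [//|/forallPn[i]] := boolP [forall i, x 0 i == 0]; last by exists i.
  move=> /forallP x0; case/eqP: x_neq0; apply/rowP => i; rewrite mxE.
  exact/eqP.
have zsub u : a * z u <= \sum_(v | edge u v) z v.
  have := congr1 (fun r : 'rV_#|G| => r 0 (enum_rank u)) xA.
  rewrite !mxE => def_au.
  apply: le_trans (_ : `|a * x 0 (enum_rank u)| <= _).
    by rewrite normrM; apply: ler_wpM2r; [exact: normr_ge0 | exact: ler_norm].
  rewrite -def_au (reindex (@enum_rank G)) /=; last exact/onW_bij/enum_rank_bij.
  apply: le_trans (ler_norm_sum _ _ _) _; rewrite [leRHS]big_mkcond /=.
  apply: ler_sum => v _; rewrite mxE !enum_rankK edge_sym normrM normr_nat.
  by case: ifP; rewrite ?mulr1 ?mulr0.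
pose m := [arg max_(u > enum_val i) z u]%O.
have max_m u : z u <= z m by rewrite /m; case: arg_maxP => // j _; apply.
have zm_gt0 : 0 < z m.
  by apply: lt_le_trans (max_m (enum_val i)); rewrite /z enum_valK normr_gt0.
exists (fun u => z u / z m); split.
- move=> u; rewrite (divr_ge0 (normr_ge0 _) (ltW zm_gt0)) /=.
  by rewrite ler_pdivrMr // mul1r.
- by exists m; rewrite divff // gt_eqF.
- by move=> u; rewrite -mulr_suml mulrA ler_wpM2r // invr_ge0 ltW.
Qed.

Section Subeigenvector.

Variables (R : realType) (G : sgraph) (y : G -> R) (a : R) (w : G).
Hypotheses (y_ge0 : forall v, 0 <= y v) (y_le1 : forall v, y v <= 1).
Hypotheses (yw : y w = 1) (a_gt0 : 0 < a).
Hypothesis (ay : forall v, a * y v <= \sum_(u | edge v u) y u).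

Lemma sum_le_card (P : pred G) : \sum_(u | P u) y u <= #|[set u | P u]|%:R.
Proof.
rewrite -sum1_card natr_sum (eq_bigl P) => [|u]; last by rewrite inE.
exact: ler_sum.
Qed.

Lemma subeigenvector_degree v : a * y v <= (degree v)%:R.
Proof. exact: le_trans (ay v) (sum_le_card _). Qed.

(** In the row of [w], where [y w = 1], the vertices other than [w] must supply at least [a]. *)
Lemma sum_deficiency : \sum_v (1 - y v) <= #|G|%:R - 1 - a.
Proof.
have : a <= \sum_(u | u != w) y u.
  have := ay w; rewrite yw mulr1 => /le_trans; apply.
  rewrite [leLHS]big_mkcond [leRHS]big_mkcond; apply: ler_sum => u _.
  by case: eqVneq => [->|_] /=; [rewrite edge_irr | case: ifP => _; rewrite ?lexx ?y_ge0].
have def_S : \sum_u y u = 1 + \sum_(u | u != w) y u by rewrite (bigD1 w) //= yw.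
rewrite sumrB def_S sumr_const; lra.
Qed.

(** A degree of at most [2 * a / 3] forces [y t <= 2 / 3], so each vertex of [T] takes at least 1/3
    of the total deficiency. *)
Lemma card_low_degree (T : {set G}) :
  {in T, forall t, 3 * (degree t)%:R <= 2 * a} ->
  #|T|%:R <= 3 * (#|G|%:R - 1 - a).
Proof.
move=> low; have : (#|T|%:R : R) <= 3 * \sum_v (1 - y v).
  rewrite -sum1_card natr_sum mulr_sumr big_mkcond; apply: ler_sum => t _.
  case: ifP => [tT|_]; last by rewrite mulr_ge0 // subr_ge0.
  have := low t tT; have := subeigenvector_degree t; have := a_gt0.
  move: (y t) => yt ? ? ?; suff : 3 * yt <= 2 by lra.
  by rewrite -(ler_pM2l a_gt0); lra.
by move=> /le_trans; apply; rewrite ler_wpM2l // sum_deficiency.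
Qed.

Variables (T : {set G}) (d : nat).
Hypothesis degT : {in T, forall t, (degree t <= d)%N}.

Let S := \sum_(t in T) y t.

Lemma sum_low_degree : a * S <= (#|T| * d)%:R.
Proof.
rewrite mulr_sumr natrM mulr_natl -sumr_const; apply: ler_sum => t tT.
by apply: le_trans (subeigenvector_degree t) _; rewrite ler_nat degT.
Qed.

Lemma sum_adj_split v : a * y v <= \sum_(u in ~: T | edge v u) y u + S.
Proof.
apply: le_trans (ay v) _; rewrite (bigID [in T]) /= addrC lerD //.
  by rewrite le_eqVlt; apply/orP; left; apply/eqP/eq_bigl => u; rewrite inE andbC.
rewrite [leLHS]big_mkcond [leRHS]big_mkcond; apply: ler_sum => u _.
by case: (u \in T); rewrite (andbT, andbF) //; case: ifP.
Qed.

Hypothesis lt_da : d%:R < a.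

Lemma maximum_outside : w \in ~: T.
Proof.
rewrite inE; apply/negP => /degT; rewrite -(ler_nat R) => le_d.
have := subeigenvector_degree w; rewrite yw mulr1 => le_a.
by have := le_lt_trans (le_trans le_a le_d) lt_da; rewrite ltxx.
Qed.

(** In the row of [w], the vertices outside [T] contribute at most [#|~: T| - 1], since [w] is one
    of them and not its own neighbour; [T] contributes at most [S <= #|T| * d / a]. *)
Lemma subeigenvector_bound : a <= #|~: T|%:R - 1 + (#|T| * d)%:R / a.
Proof.
have wT := maximum_outside.
have S_le : S <= (#|T| * d)%:R / a by rewrite ler_pdivlMr // mulrC sum_low_degree.
have := sum_adj_split w; rewrite yw mulr1.
have : \sum_(u in ~: T | edge w u) y u <= #|~: T|%:R - 1.
  apply: le_trans (sum_le_card _) _.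
  rewrite (cardsD1 w (~: T)) wT natrD addrAC subrr add0r ler_nat.
  apply: subset_leq_card; apply/subsetP => u; rewrite !inE => /andP[-> ewu].
  by rewrite andbT; apply: contraTneq ewu => ->; rewrite edge_irr.
lra.
Qed.

(* At the maximum [w], every vertex outside [T] has a value at least [1 - S],
   while summing [a * y <= A y] over [~: T] bounds [y u + y v] by [d * S]. *)
Lemma subeigenvector_nonedge u v :
  #|~: T|%:R - 1 <= a -> u \in ~: T -> v \in ~: T -> u != v -> ~~ edge u v ->
  2 * a <= (#|T| * d * (d + 2))%:R.
Proof.
move=> a_ge uT vT ne_uv nuv.
have wT := maximum_outside.
have S_ge0 : 0 <= S by apply: sumr_ge0.
have low r : r \in ~: T -> 1 - S <= y r.
  move=> rT; have [->|ne_rw] := eqVneq r w; first by rewrite yw lerBlDr lerDl.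
  have := sum_adj_split w; rewrite yw mulr1.
  have : \sum_(s in ~: T | edge w s) y s <= y r + (#|~: T|%:R - 2).
    apply: le_trans (_ : \sum_(s in ~: T | s != w) y s <= _).
      rewrite [leLHS]big_mkcondr [leRHS]big_mkcondr; apply: ler_sum => s _.
      by case: eqVneq => [->|_] /=; [rewrite edge_irr | case: ifP => _; rewrite ?lexx ?y_ge0].
    rewrite (bigD1 r) /=; last by rewrite rT.
    rewrite lerD2l; apply: le_trans (sum_le_card _) _.
    rewrite (cardsD1 w (~: T)) wT (cardsD1 r (~: T :\ w)) !inE ne_rw -in_setC rT.
    rewrite !natrD addrA [_ - 2]addrC addrA (_ : -2 + (1 + 1) = 0 :> R); last by ring.
    rewrite add0r ler_nat; apply: subset_leq_card; apply/subsetP => s.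
    by rewrite !inE => /andP[/andP[-> ->] ->].
  lra.
(* After exchanging the sums, [y s] has weight [dR s]. This is at most [d] on [T] and at most
   [#|~: T| - 1] elsewhere, with one less at [u] and at [v], which miss each other. *)
pose dR s := #|[set r in ~: T | edge s r]|.
have weighted : a * \sum_(r in ~: T) y r <=
    (#|~: T|%:R - 1) * \sum_(r in ~: T) y r - y u - y v + d%:R * S.
  have : a * \sum_(r in ~: T) y r <= \sum_s (dR s)%:R * y s.
    rewrite mulr_sumr.
    apply: le_trans (_ : \sum_(r in ~: T) \sum_(s | edge r s) y s <= _).
      by apply: ler_sum => r _; apply: ay.
    rewrite (exchange_big_dep predT) //= le_eqVlt; apply/orP; left; apply/eqP.
    apply: eq_bigr => s _; rewrite mulr_natl -sumr_const; apply: eq_bigl => r.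
    by rewrite !inE edge_sym.
  move=> /le_trans; apply; rewrite (bigID [in T]) /= addrC; apply: lerD; last first.
    rewrite mulr_sumr; apply: ler_sum => t tT; rewrite ler_wpM2r // ler_nat.
    apply: leq_trans (degT tT); apply: subset_leq_card; apply/subsetP => r.
    by rewrite !inE => /andP[].
  have ind x : x \in ~: T -> y x = \sum_(s in ~: T) (s == x)%:R * y s.
    move=> xT; rewrite (bigD1 x) //= eqxx mul1r big1 ?addr0 // => s /andP[_ /negPf->].
    by rewrite mul0r.
  rewrite (ind u) // (ind v) // mulr_sumr -!sumrB.
  rewrite (eq_bigl [in ~: T]) => [|s]; last by rewrite inE.
  apply: ler_sum => s sT; rewrite -!mulrBl ler_wpM2r //.
  rewrite -addrA -opprD lerBrDr -natrD lerBrDr -natrD natr1 ler_nat.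
  rewrite (cardsD1 s (~: T)) sT ltnS.
  have nonedge x : x \in ~: T -> x != s -> ~~ edge s x -> (dR s < #|~: T :\ s|)%N.
    move=> xT ne_xs nsx; rewrite (cardsD1 x (~: T :\ s)) !inE ne_xs -in_setC xT ltnS.
    apply: subset_leq_card; apply/subsetP => r; rewrite !inE => /andP[-> sr].
    rewrite andbT; apply/andP; split; first by apply: contraNneq nsx => <-.
    by apply: contraTneq sr => ->; rewrite edge_irr.
  have [eq_su|_] := eqVneq s u.
    by rewrite eq_su (negPf ne_uv) addn1 -eq_su; apply: (nonedge v); rewrite // eq_su 1?eq_sym.
  have [eq_sv|_] := eqVneq s v.
    by rewrite addn1; apply: (nonedge u); rewrite // eq_sv // edge_sym.
  rewrite addn0; apply: subset_leq_card; apply/subsetP => r.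
  rewrite !inE => /andP[-> sr]; rewrite andbT.
  by apply: contraTneq sr => ->; rewrite edge_irr.
have sum_ge0 : 0 <= \sum_(r in ~: T) y r by apply: sumr_ge0.
have uv_le : y u + y v <= d%:R * S.
  have := ler_wpM2r sum_ge0 a_ge; lra.
(* Adding [low] at [u] and [v] gives [2 - 2 * S <= y u + y v <= d * S]. *)
have S_ge : 2 <= (d%:R + 2) * S.
  by have := low u uT; have := low v vT; lra.
have := sum_low_degree; have := ler_wpM2l (ltW a_gt0) S_ge.
rewrite [X in _ -> _ -> _ <= X]natrM natrD => ? aS.
have : (d%:R + 2) * (a * S) <= (d%:R + 2) * (#|T| * d)%:R.
  by rewrite ler_wpM2l // addr_ge0.
lra.
Qed.

End Subeigenvector.
End SpectralRadius.

(** * Hamilton cycles on a vertex set and the Bondy-Chvatal closure *)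

Definition hamiltonian_on (V : finType) (D : {set V}) (e : rel V) : Prop :=
  exists p : seq V, [/\ 2 < size p, ucycle e p & p =i D].

(** As in [hamiltonian_on], the vertex type stays fixed, so that edges and vertex sets can vary
    without passing to induced graphs. *)
Definition degree_in (V : finType) (D : {set V}) (e : rel V) (u : V) : nat :=
  #|[set v in D | e u v]|.

(** Pigeonhole over the [size s] consecutive pairs: [Q] marks a pair by its first entry and [P] by
    its second, and with more marks than pairs some pair is marked twice. *)
Lemma consecutive_pair (T : Type) (P Q : pred T) (x : T) (s : seq T) :
  size s < count P s + count Q (belast x s) ->
  exists s1 a b s2, [/\ x :: s = s1 ++ a :: b :: s2, Q a & P b].
Proof.
elim: s x => [|y s IHs] x //=.
have [/andP[Qx Py] _|nQP lt_s] := boolP (Q x && P y).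
  by exists [::], x, y, s.
have /IHs[s1 [a [b [s2 [-> Qa Pb]]]]] : size s < count P s + count Q (belast y s).
  by move: nQP lt_s; case: (Q x); case: (P y) => //=; lia.
by exists (x :: s1), a, b, s2.
Qed.

(* Chvatal's crossing: if [a], [b] are consecutive on the path, [a] is adjacent
   to its last vertex and [b] to its first one, reverse the part after [a]. *)
Lemma path_crossing (V : eqType) (e : rel V) (x : V) (s : seq V) :
  symmetric e -> path e x s ->
  size s < count (e x) s + count (e (last x s)) (belast x s) ->
  exists2 p, cycle e p & perm_eq p (x :: s).
Proof.
move=> e_sym xs_path lt_s.
have [s1 [a [b [s2 [def_s ea eb]]]]] := consecutive_pair lt_s.
exists (rcons s1 a ++ rev (b :: s2)); last first.
  by rewrite def_s cat_rcons perm_cat2l perm_cons perm_rev.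
have {}def_s : x :: s = rcons s1 a ++ b :: s2 by rewrite cat_rcons.
have def_z : last x s = last b s2.
  by have := congr1 (last x) def_s; rewrite last_cat.
rewrite (cycle_path x) last_cat rev_cons last_rcons -rev_cons cat_path last_rcons.
case def_q : (rcons s1 a) def_s => [|x' q]; first by case: s1 def_q {ea eb}.
case=> ? def_s; subst x'.
move: xs_path; rewrite def_s cat_path /= => /and3P[q_path _ s2_path].
rewrite e_sym eb q_path /= lastI rev_rcons /= e_sym -def_z ea def_z.
by rewrite rev_path; apply: sub_path s2_path => u v; rewrite /= e_sym.
Qed.

Definition add_edge (V : eqType) (e : rel V) (u v : V) : rel V :=
  fun x y => [|| e x y, (x == u) && (y == v) | (x == v) && (y == u)].

Section BondyChvatal.

Variables (V : finType) (D : {set V}).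
Implicit Types e : rel V.

Lemma count_degree_in e u p :
  uniq p -> p =i D -> count (e u) p = degree_in D e u.
Proof.
move=> p_uniq p_D; rewrite -size_filter -(card_uniqP (filter_uniq _ p_uniq)).
by apply: eq_card => v; rewrite mem_filter inE p_D andbC.
Qed.

(** A Hamilton cycle avoiding the added edge would be one of [e]; cutting any other at that edge
    leaves a path of [e] between [u] and [v]. *)
Lemma add_edge_path e u v :
  symmetric e -> u \in D -> ~ hamiltonian_on D e ->
  hamiltonian_on D (add_edge e u v) ->
  exists x s, [/\ path e x s, uniq (x :: s), x :: s =i D &
    x = u /\ last x s = v \/ x = v /\ last x s = u].
Proof.
move=> e_sym uD nham [p [p_gt2 /andP[p_cycle p_uniq] p_D]].
have /rot_to[i q def_p] : u \in p by rewrite p_D.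
move: p_cycle p_uniq p_gt2; rewrite -(rot_cycle i) -(rot_uniq i) -(size_rot i).
have {}p_D : rot i p =i D by move=> x; rewrite mem_rot.
move: p_D; rewrite def_p; case: q {def_p} => // y q yq_D.
rewrite [cycle _ _]/= [uniq _]/= [size _]/= in_cons negb_or.
move=> /andP[uy_adj q_path] /and3P[/andP[ne_uy uNq] yNq q_uniq] q_gt0.
(* Away from [u] nothing has changed, so only the two cycle edges at [u] can be the added one. *)
have agree : {in predC1 u &, forall a b, add_edge e u v a b = e a b}.
  by move=> a b; rewrite !inE /add_edge => /negPf-> /negPf->; rewrite andbF !orbF.
move: q_path; rewrite rcons_path => /andP[q_path last_adj].
have {}q_path : path e y q.
  rewrite -(eq_in_path agree) //=; rewrite [y == u]eq_sym ne_uy /=.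
  by apply/allP => a aq; rewrite inE; apply: contraNneq uNq => <-.
have lastNu : last y q != u.
  have : last y q \in y :: q by rewrite mem_last.
  rewrite inE => /orP[/eqP->|]; first by rewrite eq_sym.
  by apply: contraTneq => ->.
have last_e : last y q != v -> e (last y q) u.
  move=> /negPf nv; move: last_adj; rewrite /add_edge nv (negPf lastNu) /=.
  by rewrite orbF.
have uy_e : y != v -> e u y.
  move=> /negPf nv; move: uy_adj; rewrite /add_edge nv [y == u]eq_sym (negPf ne_uy).
  by rewrite !andbF !orbF.
(* The cycle has more than two vertices, so [y] and [last y q] differ and at most one of them is
   [v]. *)
have [eq_yv|ne_yv] := eqVneq y v.
  exists y, (rcons q u); rewrite last_rcons; split.
  - rewrite rcons_path q_path last_e // -eq_yv.
    case: (q) q_gt0 yNq => //= z q' _; apply: contraNneq => {1}<-.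
    exact: mem_last.
  - by rewrite /= mem_rcons rcons_uniq inE eq_sym negb_or ne_uy yNq uNq.
  - by move=> x; rewrite -yq_D !inE mem_rcons !inE orbCA.
  - by right.
have [eq_lv|/last_e lu_e] := eqVneq (last y q) v.
  exists u, (y :: q); split=> //; last by left.
    by rewrite /= uy_e.
  by rewrite /= inE negb_or ne_uy uNq yNq.
case: nham; exists [:: u, y & q]; split=> //.
by rewrite /ucycle /= rcons_path uy_e // q_path lu_e inE negb_or ne_uy uNq yNq.
Qed.

(** The ends of the path left by the cut have degree sum at least [#|D|], one more than its number
    of edges, so the crossing closes it into a cycle of [e]. *)
Lemma bondy_chvatal e u v :
  symmetric e -> irreflexive e -> u \in D -> 2 < #|D| ->
  #|D| <= degree_in D e u + degree_in D e v ->
  hamiltonian_on D (add_edge e u v) -> hamiltonian_on D e.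
Proof.
move=> e_sym e_irr uD D_gt2 degs ham; apply: contrapT => nham.
have [x [s [xs_path xs_uniq xs_D ends]]] := add_edge_path e_sym uD nham ham.
have size_xs : #|D| = (size s).+1.
  by rewrite -(eq_card xs_D) (card_uniqP xs_uniq).
have [|p p_cycle p_xs] := path_crossing e_sym xs_path.
  have -> : count (e x) s = count (e x) (x :: s) by rewrite /= e_irr.
  set z := last x s.
  have -> : count (e z) (belast x s) = count (e z) (x :: s).
    by rewrite lastI -cats1 count_cat /= e_irr !addn0.
  rewrite !count_degree_in // -size_xs.
  by case: ends => -[eq_x eq_z]; rewrite /z eq_z eq_x // addnC.
apply: nham; exists p; split.
- by rewrite (perm_size p_xs) /= -size_xs.
- by rewrite /ucycle p_cycle (perm_uniq p_xs).
- by move=> y; rewrite (perm_mem p_xs).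
Qed.

(** This is the closure process: joining a non-adjacent pair of degree sum at least [#|D|] keeps the
    graph non-Hamiltonian, and the number of non-adjacent pairs drops. *)
Lemma edge_maximal_nonhamiltonian e :
  symmetric e -> irreflexive e -> 2 < #|D| -> ~ hamiltonian_on D e ->
  exists e' : rel V, [/\ symmetric e', irreflexive e', subrel e e',
    ~ hamiltonian_on D e' &
    {in D &, forall u v, u != v -> ~~ e' u v ->
      degree_in D e' u + degree_in D e' v < #|D|}].
Proof.
move=> + + D_gt2; have [m] := ubnP #|[set uv : V * V | ~~ e uv.1 uv.2]|.
elim: m e => // m IHm e /ltnSE le_m e_sym e_irr nham.
pose bad u v := [&& u \in D, v \in D, u != v, ~~ e u v &
  #|D| <= degree_in D e u + degree_in D e v].
have [/existsP[u /existsP[v /and5P[uD vD ne_uv nuv degs]]]|] :=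
  boolP [exists u, exists v, bad u v]; last first.
  move=> /existsPn good; exists e; split=> // u v uD vD ne_uv nuv.
  rewrite ltnNge; apply/negP => degs.
  by have /existsPn/(_ v)/negP[] := good u; rewrite /bad uD vD ne_uv nuv.
have [||||e' [e'_sym e'_irr sub nham' max]] := IHm (add_edge e u v).
- apply: leq_trans le_m; apply: proper_card; apply/properP; split.
    by apply/subsetP => -[x y]; rewrite !inE /= !negb_or => /andP[].
  by exists (u, v); rewrite !inE //= /add_edge !eqxx orbT.
- move=> x y; rewrite /add_edge e_sym; congr (_ || _).
  by rewrite orbC; congr (_ || _); rewrite andbC.
- move=> x; rewrite /add_edge e_irr /=.
  by apply/negP => /orP[] /andP[/eqP-> /eqP eq_uv]; rewrite eq_uv eqxx in ne_uv.
- by move/(bondy_chvatal e_sym e_irr uD D_gt2 degs).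
exists e'; split=> // x y exy; apply: sub; by rewrite /add_edge exy.
Qed.

End BondyChvatal.

(** * Hamilton cycles through a clique with a small set attached *)

Lemma clique_sorted (V : eqType) (e : rel V) (s : seq V) :
  uniq s -> {in s &, forall x y, x != y -> e x y} -> sorted e s.
Proof.
move=> s_uniq clique; apply: pairwise_sorted.
by move: s_uniq; rewrite uniq_pairwise; apply: sub_in_pairwise (allss s).
Qed.

Section Structure.

Variables (V : finType) (e : rel V).
Hypotheses (e_sym : symmetric e) (e_irr : irreflexive e).

Lemma clique_hamiltonian (D : {set V}) :
  2 < #|D| -> {in D &, forall x y, x != y -> e x y} -> hamiltonian_on D e.
Proof.
move=> D_gt2 clique.
exists (enum D); split; [by rewrite -cardE | | by move=> x; rewrite mem_enum].
rewrite /ucycle enum_uniq andbT.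
have := enum_uniq D; have := @mem_enum V D; have : size (enum D) > 2 by rewrite -cardE.
case: (enum D) => //= x s s_gt1 xs_D /andP[xNs s_uniq].
rewrite rcons_path; apply/andP; split.
  apply: (@clique_sorted _ e (x :: s)); first by rewrite /= xNs.
  by move=> u v; rewrite !xs_D; apply: clique.
have ls : last x s \in s by case: (s) s_gt1 => //= y s' _; apply: mem_last.
apply: clique; rewrite -?xs_D ?inE ?eqxx ?ls ?orbT //.
by apply: contraNneq xNs => <-.
Qed.

(* Replace the clique [K :\: B], whose vertices are twins, by one vertex [z] in
   it. The degree condition is now relative to a small set, and the cycle found
   there passes through [z] between two vertices of [B]. *)
Lemma attached_hamiltonian (K T B : {set V}) (z : V) :
  [disjoint K & T] -> B \subset K -> z \in K :\: B -> 1 < #|B| -> 0 < #|T| ->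
  {in K &, forall x y, x != y -> e x y} ->
  (forall t v, t \in T -> v \in K -> e t v = (v \in B)) ->
  {in T &, forall t t', t != t' -> ~~ e t t' ->
    #|T| + #|B| < degree_in (T :|: B) e t + degree_in (T :|: B) e t'} ->
  hamiltonian_on (K :|: T) e.
Proof.
move=> KT_disj /subsetP BK; rewrite inE => /andP[zNB zK].
move=> B_gt1 T_gt0 Kclique TK degs.
have KT x : x \in K -> ~ x \in T by move=> xK; rewrite (disjointFr KT_disj xK).
set D := z |: (T :|: B).
have BNT b : b \in B -> b \notin T by move=> /BK bK; apply/negP => /(KT b bK).
have TNB t : t \in T -> t \notin B by move=> tT; apply: contraL tT => /BNT.
have zNT : z \notin T by apply/negP; apply: KT.
have card_D : #|D| = (#|T| + #|B|).+1.
  rewrite cardsU1 !inE negb_or zNT zNB add1n cardsU.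
  suff -> : T :&: B = set0 by rewrite cards0 subn0.
  by apply/setP => x; rewrite !inE; apply/andP => -[/TNB/negP].
have D_gt2 : 2 < #|D| by rewrite card_D; lia.
have [p [p_gt2 /andP[p_cycle p_uniq] p_D]] : hamiltonian_on D e.
  apply: contrapT => /(edge_maximal_nonhamiltonian e_sym e_irr D_gt2).
  case=> e' [e'_sym _ sub nham' max]; apply: nham'.
  (* As [#|D| = #|T| + #|B| + 1], the degree hypothesis leaves no missing edge inside [T] in the
     closure. *)
  have Tclique : {in T &, forall t t', t != t' -> e' t t'}.
    move=> t t' tT t'T ne_tt'; apply/negPn/negP => ntt'.
    have := max t t'; rewrite !inE tT t'T !orbT => /(_ isT isT ne_tt' ntt').
    apply/negP; rewrite -leqNgt card_D.
    have {ntt'}ntt' : ~~ e t t' by apply: contra ntt'; apply: sub.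
    apply: leq_trans (degs t t' tT t'T ne_tt' ntt') _.
    apply: leq_add; apply: subset_leq_card; apply/subsetP => v; rewrite !inE;
      by move=> /andP[-> /sub->]; rewrite orbT.
  have [b bB] : exists b, b \in B by apply/card_gt0P; lia.
  have TBclique : {in T :|: B &, forall x y, x != y -> e' x y}.
    move=> x y; rewrite !inE => /orP[xT|xB] /orP[yT|yB] ne_xy.
    - exact: Tclique.
    - by apply: sub; rewrite TK ?BK.
    - by rewrite e'_sym; apply: sub; rewrite TK ?BK.
    - by apply: sub; rewrite Kclique ?BK.
  (* Since [1 < #|B|], this ordering of the clique [T :|: B] starts and ends in [B], hence closes up
     through [z]. *)
  pose q := enum (B :\ b) ++ enum T ++ [:: b].
  have qTB : q =i T :|: B.
    move=> x; rewrite !mem_cat !mem_enum !inE.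
    by case: eqVneq => [->|_]; rewrite ?bB ?orbT //= orbF orbC.
  have q_uniq : uniq q.
    rewrite /q !cat_uniq !enum_uniq /= has_cat /= !mem_enum !inE eqxx /= !orbF BNT //=.
    rewrite andbT; apply/hasPn => x; rewrite !mem_enum !inE => /TNB/negPf->.
    by rewrite andbF.
  exists (z :: q); split.
  - rewrite /= ltnS -(card_uniqP q_uniq) (eq_card qTB).
    by move: D_gt2; rewrite /D cardsU1 !inE negb_or zNT zNB.
  - have zNq : z \notin q by rewrite qTB !inE negb_or zNT.
    rewrite /ucycle /= zNq q_uniq andbT rcons_path.
    have zB x : x \in B -> e' z x.
      move=> xB; apply: sub; apply: Kclique => //; first exact: BK.
      by apply: contraNneq zNB => ->.
    have -> : last z q = b by rewrite /q !last_cat.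
    rewrite e'_sym zB // andbT.
    have : sorted e' q.
      by apply: clique_sorted => // u v; rewrite !qTB; apply: TBclique.
    case def_q : q => [|x q'] //= ->; rewrite !andbT; apply: zB.
    have : 0 < #|B :\ b| by move: B_gt1; rewrite (cardsD1 b) bB; lia.
    rewrite cardE; case def_B : (enum (B :\ b)) => [|x' s] // _.
    have : x' \in B :\ b by rewrite -mem_enum def_B mem_head.
    by move: def_q; rewrite /q def_B => -[-> _]; rewrite inE => /andP[].
  - by move=> x; rewrite in_cons qTB /D !inE.
(* Start the cycle at [z]. Both its neighbours there lie in [B], so any ordering of [K :\: B] can
   take its place. *)
have /rot_to[i s def_p] : z \in p by rewrite p_D !inE eqxx.
move: p_cycle p_uniq p_gt2; rewrite -(rot_cycle i) -(rot_uniq i) -(size_rot i).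
have {}p_D : rot i p =i D by move=> x; rewrite mem_rot.
move: p_D; rewrite def_p; case: s {def_p} => // x s xs_D.
rewrite [cycle _ _]/= [uniq _]/= [size _]/= !ltnS rcons_path => /and3P[zx s_path lz].
move=> /andP[zNxs xs_uniq] s_gt0.
have zD u : u \in x :: s -> e z u -> u \in B.
  move=> us zu; have : u \in D by rewrite -xs_D in_cons us orbT.
  rewrite !inE => /orP[/eqP eq_u|/orP[uT|//]].
    by rewrite eq_u e_irr in zu.
  by move: zu; rewrite e_sym TK // (negPf zNB).
have xB := zD x (mem_head _ _) zx.
have lB : last x s \in B by apply: zD; rewrite ?mem_last // e_sym.
have xsTB u : (u \in x :: s) = (u \in T :|: B).
  have := xs_D u; rewrite in_cons /D in_setU1; case: eqVneq => // -> _.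
  by rewrite (negPf zNxs) !inE (negPf zNT) (negPf zNB).
have KB_adj : {in K :\: B & B, forall u v, e u v}.
  move=> u v; rewrite inE => /andP[uNB uK] vB; apply: Kclique => //; first exact: BK.
  by apply: contraNneq uNB => ->.
have := enum_uniq (K :\: B); have := @mem_enum V (K :\: B).
case: (enum _) => [/(_ z)|y r yr_KB yr_uniq]; first by rewrite !inE zNB zK.
have yr_KB' u : u \in y :: r -> u \in K :\: B by rewrite yr_KB.
exists ((y :: r) ++ x :: s); split.
- by rewrite size_cat /= addnS !ltnS (leq_trans s_gt0) ?leq_addl.
- rewrite /ucycle cat_uniq yr_uniq (xs_uniq : uniq (x :: s)) andbT /=.
  apply/andP; split; last first.
    rewrite -[_ || _]/(has (mem (y :: r)) (x :: s)); apply/hasPn => u.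
    rewrite xsTB; apply: contraL => /yr_KB'; rewrite !inE negb_or => /andP[-> uK].
    by rewrite andbT; apply/negP; apply: KT.
  rewrite rcons_cat cat_path /= rcons_path s_path.
  rewrite (KB_adj (last y r)) ?yr_KB' ?mem_last //.
  rewrite e_sym (KB_adj y) ?yr_KB' ?mem_head // !andbT.
  apply: (@clique_sorted _ e (y :: r)) => // u v /yr_KB' + /yr_KB'.
  by rewrite !inE => /andP[_ uK] /andP[_ vK]; apply: Kclique.
- move=> u; rewrite mem_cat xsTB yr_KB !inE.
  by have := BK u; case: (u \in B) => [->|] //=; rewrite ?orbT // orbF.
Qed.

End Structure.


(** * Structure of the closure when the degree bounds are tight *)

Section NonHamiltonian.

Variables (V : finType) (e e' : rel V) (X T : {set V}) (k c : nat).

Let D := ~: X.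
Let K := D :\: T.

Lemma in_neighbors (A : {set V}) (r : rel V) u v :
  (v \in [set x in A | r u x]) = (v \in A) && r u v.
Proof. by rewrite inE. Qed.

Lemma degree_in_split (A : {set V}) (r : rel V) v :
  #|[set u | r v u]| = degree_in (~: A) r v + degree_in A r v.
Proof.
rewrite -(cardsID A) addnC; congr (_ + _); apply: eq_card => u;
  by rewrite !inE // andbC.
Qed.

Lemma degree_in_sub (A B : {set V}) (r r' : rel V) v :
  {subset A <= B} -> subrel r r' -> degree_in A r v <= degree_in B r' v.
Proof.
move=> AB rr'; apply: subset_leq_card; apply/subsetP => u.
by rewrite !inE => /andP[/AB-> /rr'->].
Qed.

Lemma degree_in_le (A : {set V}) (r : rel V) v : degree_in A r v <= #|A|.
Proof. by apply: subset_leq_card; apply/subsetP => u; rewrite inE => /andP[]. Qed.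

(* [q] is true when the graph lies in L and false when it lies in H. *)
Lemma nonhamiltonian_structure :
  symmetric e' -> irreflexive e' ->
  subrel e e' -> ~ hamiltonian_on D e' ->
  {in D &, forall u v, u != v -> ~~ e' u v ->
    degree_in D e' u + degree_in D e' v < #|D|} ->
  {in K &, forall u v, u != v -> e' u v} ->
  #|X| <= k -> 1 < c -> 2 * c + 2 < #|D| ->
  (forall v, k + c <= #|[set u | e v u]|) ->
  T \subset D -> #|T| <= c -> {in T, forall t, degree_in D e' t <= #|T|} ->
  exists q : bool, exists A : {set V}, [/\ #|T| = c, [disjoint A & T],
    #|A| = if q then k.+1 else k + c &
    {in T, forall t u, e t u = (u \in A) || [&& q, u \in T & t != u]}].
Proof.
move=> e'_sym e'_irr sub nham max Kclique X_le c_gt1 D_large deg_ge TD T_le T_deg.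
have [t0 t0T] : exists t, t \in T.
  have [T0|/set0Pn//] := eqVneq T set0.
  case: nham; apply: clique_hamiltonian; first by lia.
  by rewrite -[D]setD0 -T0.
(* The degree of [t] in [e] is at least [k + c] and at most [#|X| + degree_in D e' t <= k + #|T| <=
   k + c], so equality holds throughout. *)
have degs t : t \in T -> [/\ #|T| = c, #|X| = k, degree_in X e t = #|X|,
    degree_in D e' t = c & degree_in D e t = c].
  move=> tT; have := deg_ge t; rewrite (degree_in_split X).
  have := degree_in_le X e t; have := T_deg t tT.
  have := @degree_in_sub D D e e' t (fun _ => id) sub; rewrite -/D.
  by move: (degree_in D e t) (degree_in D e' t) (degree_in X e t) => *; split; lia.
have [cT cX _ _ _] := degs t0 t0T.
have XD v : v \in X = (v \notin D) by rewrite !inE negbK.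
have eX t v : t \in T -> v \in X -> e t v.
  move=> tT; have [_ _ degX _ _] := degs t tT.
  have : [set u in X | e t u] == X.
    rewrite eqEcard -/(degree_in X e t) degX leqnn andbT.
    by apply/subsetP => u; rewrite inE => /andP[].
  by move/eqP => {1}<-; rewrite inE => /andP[].
have eD t v : t \in T -> v \in D -> e t v = e' t v.
  move=> tT vD; have [_ _ _ deg' deg] := degs t tT.
  have : [set u in D | e t u] == [set u in D | e' t u].
    rewrite eqEcard -/(degree_in D e t) -/(degree_in D e' t) deg deg' leqnn andbT.
    by apply/subsetP => u; rewrite !inE => /andP[-> /sub->].
  by move/eqP/setP/(_ v); rewrite !(inE, vD).
have inK v : v \in K = (v \in D) && (v \notin T) by rewrite inE andbC.
have inD v : v \in D = (v \in K) || (v \in T).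
  by rewrite inK; have := subsetP TD v; case: (v \in T) => [->|_] //; rewrite ?orbF ?andbT.
have cD : #|D| = #|K| + #|T|.
  by rewrite -(cardsID T D) addnC (setIidPr TD).
(* Otherwise [t'] has degree [c] and [v], adjacent to [t] and to the rest of [K], has degree at
   least [#|K|]: these sum to [#|D|], against [max]. *)
have twins t t' v : t \in T -> t' \in T -> v \in K -> e' t v -> e' t' v.
  move=> tT t'T vK tv; apply/negPn/negP => nt'v.
  have [_ _ _ deg' _] := degs t' t'T.
  have ne : t' != v by apply: contraTneq vK => <-; rewrite inK t'T andbF.
  have := max t' v; rewrite !inD t'T vK orbT => /(_ isT isT ne nt'v).
  apply/negP; rewrite -leqNgt deg' cD cT addnC leq_add2l.
  have : #|t |: (K :\ v)| <= degree_in D e' v.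
    apply: subset_leq_card; apply/subsetP => u; rewrite !inE.
    case/orP => [/eqP->|/andP[ne_uv /andP[uNT uX]]].
      by have := inD t; rewrite tT orbT inE e'_sym tv => ->.
    by rewrite uX; apply: Kclique; rewrite // ?inK ?inE ?uX ?uNT // eq_sym.
  apply: leq_trans; rewrite cardsU1 (cardsD1 v K) vK.
  by rewrite !in_setD tT /= andbF.
pose B := [set v in K | e' t0 v].
have BK : B \subset K by apply/subsetP => v; rewrite inE => /andP[].
have TK t v : t \in T -> v \in K -> e' t v = (v \in B).
  move=> tT vK; rewrite inE vK /=; apply/idP/idP; exact: twins.
(* The [c] neighbours of [t] in [D] are those in [T] and the whole of [B]. *)
have degT t : t \in T -> degree_in T e' t + #|B| = c.
  move=> tT; have [_ _ _ <- _] := degs t tT.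
  rewrite /degree_in -[RHS](cardsID T) addnC addnC; congr (_ + _).
    apply: eq_card => u; rewrite in_setI !in_neighbors inD.
    by case: (u \in T); rewrite ?orbT ?andbT ?andbF.
  apply: eq_card => u; rewrite in_setD in_neighbors andbA [_ && (u \in D)]andbC -inK.
  have [uK|uNK] := boolP (u \in K); first by rewrite /= TK.
  by rewrite /=; apply: contraNF uNK => /(subsetP BK).
have T_irr t : t \in T -> degree_in T e' t < #|T|.
  move=> tT; rewrite [ltnRHS](cardsD1 t) tT add1n ltnS; apply: subset_leq_card.
  apply/subsetP => u; rewrite !inE => /andP[-> tu]; rewrite andbT.
  by apply: contraTneq tu => ->; rewrite e'_irr.
have B_gt0 : 0 < #|B| by have := degT t0 t0T; have := T_irr t0 t0T; lia.
have disjA : [disjoint X :|: B & T].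
  rewrite disjoints_subset; apply/subsetP => v; rewrite in_setU in_setC => /orP[|].
    by rewrite XD; apply: contra; apply: (subsetP TD).
  by move/(subsetP BK); rewrite inK => /andP[].
have cA : #|X :|: B| = k + #|B|.
  rewrite cardsU cX (_ : X :&: B = set0) ?cards0 ?subn0 //.
  apply/setP => v; rewrite !inE; apply/and3P => -[vX].
  by rewrite vX andbF.
have reduce q : (forall t u, t \in T -> u \in T -> e' t u = q && (t != u)) ->
    {in T, forall t u, e t u = (u \in X :|: B) || [&& q, u \in T & t != u]}.
  move=> qT t tT u; rewrite in_setU; have [uX|uNX] := boolP (u \in X).
    by rewrite eX.
  have uD : u \in D by rewrite inE.
  rewrite eD //=; have [uT|uNT] := boolP (u \in T).
    rewrite qT //= (_ : u \in B = false) //.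
    by apply/negP => /(subsetP BK); rewrite inK uT andbF.
  by rewrite andbF orbF TK // inK uD uNT.
(* If [#|B| = 1], each [t] has [c - 1] neighbours in [T], which is thus a clique. *)
have [B1|B_neq1] := eqVneq #|B| 1.
  exists true, (X :|: B); split; rewrite // ?cA ?B1 ?addn1 //.
  apply: reduce => t u tT uT /=.
  have : [set v in T | e' t v] == T :\ t.
    rewrite eqEcard; apply/andP; split.
      apply/subsetP => v; rewrite !inE => /andP[-> tv]; rewrite andbT.
      by apply: contraTneq tv => ->; rewrite e'_irr.
    rewrite -/(degree_in T e' t); have := degT t tT; have := cardsD1 t T.
    by rewrite tT; lia.
  by move/eqP/setP/(_ u); rewrite !inE uT andbT eq_sym.
(* If [#|B| = c], no neighbour is left in [T], which is thus independent. *)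
have [Bc|B_neqc] := eqVneq #|B| c.
  exists false, (X :|: B); split; rewrite // ?cA ?Bc //.
  apply: reduce => t u tT uT /=.
  have : degree_in T e' t = 0 by have := degT t tT; lia.
  by move/eqP; rewrite cards_eq0 => /eqP/setP/(_ u); rewrite !inE uT.
(* In between, two vertices of [T] have degree sum at least [2 * c > #|T| + #|B|] inside [T :|: B],
   and there is a Hamilton cycle. *)
have B_lt : #|B| < c by have := degT t0 t0T; lia.
have [z zKB] : exists z, z \in K :\: B.
  apply/card_gt0P; have := cardsID B K; rewrite (setIidPr BK); lia.
case: nham; rewrite (_ : D = K :|: T); last by apply/setP => v; rewrite inD !inE.
apply: (attached_hamiltonian e'_sym e'_irr (B := B) (z := z)) => //.
- by rewrite disjoints_subset; apply/subsetP => v; rewrite inK in_setC => /andP[].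
- by lia.
- by lia.
- move=> t t' tT t'T _ _; have TB u : u \in T -> c <= degree_in (T :|: B) e' u.
    move=> uT; have [_ _ _ <- _] := degs u uT.
    apply: subset_leq_card; apply/subsetP => v; rewrite !in_neighbors in_setU inD.
    by move=> /andP[/orP[vK|->//] uv]; rewrite -(TK u) // uv orbT.
  by have := TB t tT; have := TB t' t'T; lia.
Qed.

End NonHamiltonian.

(** * Induced graphs, and isomorphism from a partition into three sets *)

Lemma hamiltonian_on_induced (G : sgraph) (A : {set G}) :
  hamiltonian_on A edge -> hamiltonian (induced A).
Proof.
move=> [p [p_gt2 /andP[p_cycle p_uniq] p_A]].
have [q def_p] : exists q : seq (induced A), map val q = p.
  have : {subset p <= A} by move=> x; rewrite p_A.
  elim: p {p_gt2 p_cycle p_uniq p_A} => [|x p IHp] xp_A; first by exists [::].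
  have [|q <-] := IHp; first by move=> y yp; apply: xp_A; rewrite inE yp orbT.
  by exists (Sub x (xp_A x (mem_head _ _)) :: q).
exists q; split.
- by rewrite -(size_map val) def_p.
- rewrite /ucycle -(map_inj_uniq val_inj) def_p p_uniq andbT.
  by move: p_cycle; rewrite -def_p cycle_map.
- by move=> x; rewrite -(mem_map val_inj) def_p p_A (valP x).
Qed.

Lemma min_degree_le (G : sgraph) (v : G) : min_degree G <= degree v.
Proof.
rewrite /min_degree; have := mem_index_enum v.
elim: (index_enum _) => // u s IHs; rewrite in_cons big_cons => /predU1P[->|/IHs].
  exact: geq_minl.
by apply: leq_trans; apply: geq_minr.
Qed.

(** Taking the membership proof as an argument avoids a default rank, which does not exist when
    [n = 0]. *)
Lemma set_ranking (V : finType) (A : {set V}) (n : nat) : #|A| = n ->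
  exists r : forall x, x \in A -> 'I_n,
    forall x y (xA : x \in A) (yA : y \in A), r x xA = r y yA -> x = y.
Proof.
move=> <-; exists (fun x xA => enum_rank_in xA x) => x y xA yA.
by move=> /(congr1 enum_val); rewrite !enum_rankK_in.
Qed.

(** The rankings of [A], of [C] and of what they leave combine into an injection between types of
    equal cardinality. *)
Lemma tripartition (V : finType) (A C : {set V}) (a b c : nat) :
  [disjoint A & C] -> #|A| = a -> #|C| = c -> #|V| = a + (b + c) ->
  exists2 f : V -> 'I_a + ('I_b + 'I_c), bijective f &
    forall x, match f x with
      | inl _ => x \in A
      | inr (inl _) => (x \notin A) && (x \notin C)
      | inr (inr _) => (x \notin A) && (x \in C)
      end.
Proof.
move=> AC cA cC cV; set B := ~: (A :|: C).
have cB : #|B| = b.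
  have := cardsC (A :|: C); rewrite -/B cardsU cA cC cV.
  by rewrite (disjoint_setI0 AC) cards0; lia.
have [rA rA_inj] := set_ranking cA; have [rB rB_inj] := set_ranking cB.
have [rC rC_inj] := set_ranking cC.
have inB x : x \notin A -> x \notin C -> x \in B.
  by rewrite !inE negb_or => -> ->.
pose f x : 'I_a + ('I_b + 'I_c) :=
  match boolP (x \in A), boolP (x \in C) with
  | AltTrue xA, _ => inl (rA x xA)
  | AltFalse _, AltTrue xC => inr (inr (rC x xC))
  | AltFalse xNA, AltFalse xNC => inr (inl (rB x (inB x xNA xNC)))
  end.
exists f.
  apply: inj_card_bij; last by rewrite !card_sum !card_ord cV.
  move=> x y; rewrite /f; case: {-}_ / (boolP (x \in A)) => [xA|xNA];
    case: {-}_ / (boolP (y \in A)) => [yA|yNA]; try by [case=> /rA_inj|];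
    case: {-}_ / (boolP (x \in C)) => [xC|xNC];
    case: {-}_ / (boolP (y \in C)) => [yC|yNC] //; first by case=> /rC_inj.
  by case=> /rB_inj.
by move=> x; rewrite /f; case: {-}_ / (boolP (x \in A)) => // xNA;
  case: {-}_ / (boolP (x \in C)) => // ->; rewrite xNA.
Qed.

(** This serves both extremal graphs: the last part is complete if [q] holds and edgeless
    otherwise. *)
Lemma tripartition_isomorphic (G : sgraph) (A C : {set G}) (a b c : nat)
    (r : rel 'I_c) (r_sym : symmetric r) (r_irr : irreflexive r) (q : bool) :
  [disjoint A & C] -> #|A| = a -> #|C| = c -> #|G| = a + (b + c) ->
  (forall i j, r i j = q && (i != j)) ->
  (forall x y, edge x y = (x != y) && [|| x \in A, y \in A |
    if x \in C then (y \in C) && q else y \notin C]) ->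
  isomorphic G (join (complete_graph a)
    (disjoint_union (complete_graph b) (SGraph r_sym r_irr))).
Proof.
move=> AC cA cC cG rE eE; have [f f_bij f_parts] := tripartition AC cA cC cG.
exists f => // x y; rewrite eE -(inj_eq (bij_inj f_bij)).
have := f_parts x; have := f_parts y.
case: (f x) => [i|[i|i]]; case: (f y) => [j|[j|j]] //=.
all: rewrite ?rE /complete_rel; case: (x \in A); case: (y \in A) => //=.
all: case: (x \in C); case: (y \in C) => //= _ _; rewrite ?andbT ?andbF //.
by rewrite andbC.
Qed.

(** * From the spectral bound to the two extremal graphs *)

Theorem theorem2p5 (k delta : nat) (hdelta : k + 2 <= delta) :
  exists n0 : nat, forall (R : realType) (n : nat) (G : sgraph),
    n0 <= n -> #|G| = n -> delta <= min_degree G ->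
    (n%:R - delta%:R + k%:R - 1 <= spectral_radius R G)%R ->
    k_hamiltonian k G \/
      isomorphic G (graphH n k delta) \/ isomorphic G (graphL n k delta).
Proof.
have [c def_delta c_gt1] : exists2 c, delta = k + c & 1 < c.
  by exists (delta - k); lia.
(* The linear terms serve the degree comparisons, [3 * c * (3 * c + k)] the bound [#|T| <= c], and
   the last term the exclusion of missing edges outside [T]. *)
exists (10 * c + 7 * k + 10 + 3 * c * (3 * c + k) + c * delta * (delta + 2)).
move=> R n G n_large cG mindeg a_ge.
have [|nkham] := pselect (k_hamiltonian k G); [by left | right].
have [X X_le nhamX] : exists2 X : {set G}, #|X| <= k & ~ hamiltonian_on (~: X) edge.
  apply: contrapT => noX; apply: nkham => X X_le; apply: hamiltonian_on_induced.
  by apply: contrapT => nhamX; apply: noX; exists X.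
have deg_ge (v : G) : k + c <= degree v.
  by rewrite -def_delta; apply: leq_trans mindeg (min_degree_le v).
(* [m] is the spectral bound [n - delta + k - 1]. *)
have [m def_n] : exists m, n = m + c + 1 by exists (n - c - 1); lia.
move: (spectral_radius R G) (@spectral_radius_eigenvalue R G) a_ge => a a_eigen a_ge.
have {}a_ge : (m%:R <= a)%R.
  by move: a_ge; rewrite def_n def_delta !natrD; lra.
have a_gt (i : nat) : i < m -> (i%:R < a)%R.
  by move=> lt_im; apply: lt_le_trans a_ge; rewrite ltr_nat.
have a_gt0 : (0 < a)%R by apply: (a_gt 0); lia.
have a_gt1 : ((3 * c * (3 * c + k))%:R < a)%R by apply: a_gt; lia.
have a_gt2 : ((c * delta * (delta + 2))%:R < a)%R by apply: a_gt; lia.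
have a_gt3 : (delta%:R < a)%R by apply: a_gt; lia.
have {}n_large : 10 * c + 7 * k + 10 <= n by lia.
have [y [y_01 [w yw] ay]] := subeigenvector (a_eigen a_gt0).
have y_ge0 v : (0 <= y v)%R by have /andP[] := y_01 v.
have y_le1 v : (y v <= 1)%R by have /andP[] := y_01 v.
set D := ~: X; have cD : #|X| + #|D| = n by rewrite cardsC.
have deg_D (v : G) : degree v <= degree_in D edge v + k.
  by rewrite /degree (degree_in_split X) leq_add2l (leq_trans (degree_in_le _ _ _)).
have D_gt2 : 2 < #|D| by lia.
have [e' [e'_sym e'_irr sub nham max]] :=
  edge_maximal_nonhamiltonian (@edge_sym G) (@edge_irr G) D_gt2 nhamX.
pose T := [set v in D | 2 * degree_in D e' v < #|D|].
have TD : T \subset D by apply/subsetP => v; rewrite inE => /andP[].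
have KE v : v \in D :\: T -> v \in D /\ #|D| <= 2 * degree_in D e' v.
  rewrite in_setD [_ \in T]in_set negb_and -leqNgt => /andP[+ vD].
  by rewrite vD.
have Kclique : {in D :\: T &, forall u v, u != v -> e' u v}.
  move=> u v /KE[uD u_ge] /KE[vD v_ge] ne_uv; apply/negPn/negP => nuv.
  by move: (max u v uD vD ne_uv nuv) u_ge v_ge; clear; lia.
have deg_e' (v : G) : degree v <= degree_in D e' v + k.
  by apply: leq_trans (deg_D v) _; rewrite leq_add2r degree_in_sub.
(* A vertex of [T] has degree below [n / 2 + k], which is at most [2 * m / 3] for large [n]. *)
have T_le3 : #|T| <= 3 * c.
  have : (#|T|%:R <= 3 * (#|G|%:R - 1 - a) :> R)%R.
    apply: (card_low_degree y_ge0 y_le1 yw a_gt0 ay) => t.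
    rewrite inE => /andP[_ t_low].
    have : 3 * degree t <= 2 * m by have := deg_e' t; lia.
    by rewrite -(ler_nat R) !natrM; lra.
  rewrite -(ler_nat R) natrM cG def_n !natrD; lra.
have cK : #|D :\: T| + #|T| = #|D| by rewrite -(cardsID T D) (setIidPr TD) addnC.
(* Having low degree, [t] misses some [v] of the clique. The degree of [v] is at least
   [#|D| - #|T| - 1], and [max] bounds that of [t]. *)
have T_deg : {in T, forall t, degree_in D e' t <= #|T|}.
  move=> t tT; have tD := subsetP TD t tT.
  have t_low : 2 * degree_in D e' t < #|D| by move: tT; rewrite inE => /andP[].
  have [v vK ntv] : exists2 v, v \in D :\: T & ~~ e' t v.
    apply/exists_inP; rewrite -negb_forall_in; apply/negP => /forall_inP all_t.
    have : #|D :\: T| <= degree_in D e' t.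
      apply: subset_leq_card; apply/subsetP => v vK; rewrite in_neighbors all_t //.
      by have [->] := KE v vK.
    lia.
  have [vD _] := KE v vK.
  have ne_tv : t != v by apply: contraTneq vK => <-; rewrite in_setD tT.
  have : #|(D :\: T) :\ v| <= degree_in D e' v.
    apply: subset_leq_card; apply/subsetP => u; rewrite in_setD1 in_neighbors.
    by move=> /andP[ne_uv uK]; have [-> _] := KE u uK; rewrite Kclique // eq_sym.
  move: (max t v tD vD ne_tv ntv) (cardsD1 v (D :\: T)) cK; rewrite vK.
  by clear; lia.
have cTC : #|T| + #|~: T| = n by rewrite cardsC.
(* If [#|T| > c], then [#|~: T| <= m]; the fraction in [subeigenvector_bound] is below 1, so
   [a < m]. *)
have T_le : #|T| <= c.
  rewrite leqNgt; apply/negP => T_gt.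
  have T_low : {in T, forall t, degree t <= 3 * c + k}.
    by move=> t tT; have := deg_e' t; have := T_deg t tT; lia.
  have := subeigenvector_bound y_ge0 y_le1 yw a_gt0 ay T_low.
  have /a_gt lt_a : 3 * c + k < m by lia.
  move=> /(_ lt_a); rewrite -lerBlDl ler_pdivlMr //.
  have : ((#|T| * (3 * c + k))%:R < a)%R.
    by apply: le_lt_trans a_gt1; rewrite ler_nat leq_mul2r T_le3 orbT.
  have : (#|T|%:R + #|~: T|%:R = m%:R + c%:R + 1 :> R)%R.
    by rewrite -!natrD natr1 cTC def_n addn1.
  have : (c%:R + 1 <= #|T|%:R :> R)%R by rewrite natr1 ler_nat.
  nra.
have D_large : 2 * c + 2 < #|D| by lia.
have [q [A [cT AT cA TE]]] := nonhamiltonian_structure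
  e'_sym e'_irr sub nham max Kclique X_le c_gt1 D_large deg_ge TD T_le T_deg.
have degT : {in T, forall t, degree t <= delta}.
  by move=> t tT; have := deg_e' t; have := T_deg t tT; lia.
(* A missing edge would give [2 * a <= c * delta * (delta + 2) < a]. *)
have clique : {in ~: T &, forall u v, u != v -> edge u v}.
  move=> u v uT vT ne_uv; apply/negPn/negP => nuv.
  have a_ge' : (#|~: T|%:R - 1 <= a)%R.
    have -> : #|~: T| = m + 1 by move: cTC cT def_n; clear; lia.
    by rewrite natrD addrK.
  have := subeigenvector_nonedge y_ge0 y_le1 yw a_gt0 ay degT a_gt3 a_ge' uT vT ne_uv nuv.
  by rewrite cT; lra.
have edgeE x x' : edge x x' = (x != x') && [|| x \in A, x' \in A |
    if x \in T then (x' \in T) && q else x' \notin T].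
  have [->|ne_xy] := eqVneq x x'; first by rewrite edge_irr.
  have [xT|xNT] := boolP (x \in T).
    rewrite TE // ne_xy andbT (_ : x \in A = false); last by rewrite (disjointFl AT).
    by rewrite andbC.
  have [yT|yNT] := boolP (x' \in T).
    rewrite edge_sym TE // (negPf xNT) andbF orbF.
    by rewrite (_ : x' \in A = false) ?orbF // (disjointFl AT).
  by rewrite clique ?orbT ?in_setC.
(* [A] is the dominating clique: it has [k + 1] vertices in L and [delta] in H. *)
case: q cA TE edgeE => cA TE edgeE; [right | left].
  apply: (tripartition_isomorphic (q := true) _ _ AT) edgeE => //.
  - by rewrite cT; lia.
  - by rewrite cG; lia.
apply: (tripartition_isomorphic (q := false) _ _ AT) edgeE => //.
- by rewrite cA.
- by rewrite cT; lia.
- by rewrite cG; lia.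
Qed.
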